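(* Let $\mathbb{F}_q$ be a finite field, $\mathcal{V}$ a vector space over $\mathbb{F}_q$, and $k,t$ integers with $0\le t\le k$ and $k\ge 2t$. Let $n\ge 3$ and let $\mathcal{C}=\{\pi_1,\ldots,\pi_n\}$ be a $(k,k-t)$-SCID in $\mathcal{V}$. Define $S:=\langle \pi_1,\ldots,\pi_n\rangle$ and $I:=\langle \pi_i\cap\pi_j \mid 1\le i<j\le n\rangle$. Then \[\dim S+\dim I\le 2k+2(n-2)t-(n-3).\]
   Context: A $(k,k-t)$-SCID is a set of (distinct) $k$-dimensional subspaces of $\mathcal{V}$, containing at least two elements, such that any two distinct members intersect in a subspace of dimension exactly $k-t$. $\langle\cdot\rangle$ denotes the span. *)

(* Defs.v *)
From mathcomp Require Export all_boot all_order all_algebra.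
From mathcomp Require Export boolp classical_sets.

Set Implicit Arguments.
Unset Strict Implicit.
Unset Printing Implicit Defensive.

Import GRing.Theory.
Local Open Scope classical_set_scope.
Local Open Scope ring_scope.

(* The ambient space is an arbitrary left module over a field, so that it may be
   infinite-dimensional; [vectType] would force it to be finite-dimensional. *)
Section Subspaces.
Variables (F : fieldType) (V : lmodType F).

Definition is_subspace (U : set V) : Prop := GRing.submod_closed [in U].

Definition lspan (A : set V) : set V := smallest is_subspace A.

Definition lin_indep (d : nat) (b : 'I_d -> V) : Prop :=
  forall c : 'I_d -> F, \sum_(i < d) c i *: b i = 0 -> forall i, c i = 0.

(* A relation rather than a [nat]-valued function: it holds for no [d] when [U]
   is not a subspace or is infinite-dimensional. *)
Definition has_dim (U : set V) (d : nat) : Prop :=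
  exists b : 'I_d -> V, lin_indep b /\ lspan (range b) = U.

(* (k, m)-SCID; [m] is the dimension of the pairwise intersections. *)
Definition is_SCID (k m : nat) (C : set (set V)) : Prop :=
  [/\ exists U W, [/\ C U, C W & U <> W],
      forall U, C U -> has_dim U k
    & forall U W, C U -> C W -> U <> W -> has_dim (U `&` W) m].

End Subspaces.

(* Main.v *)
From HB Require Import structures.
Require Import Defs.
From mathcomp Require Import zify.

(** Write [D] for the dimension of the join of a family of [k]-spaces plus the
    dimension of the span of its pairwise meets. A new member [P] adds to the
    latter only vectors that it shares with the join, so by Grassmann's formula
    [D] grows by at most the codimension in [P] of the intersection of [P] with
    the span of meets. Fix two members [A] and [B], for which [D <= 2 k]. Every
    further member [P] contributes at most [2 t], because [P] contains
    [A :&: B :&: P], of dimension at least [k - 2 t]. If this dimension is never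
    minimal, each contribution is at most [2 t - 1], so
    [D <= 2 k + (n - 2) (2 t - 1)]. If it is minimal for [P = C], then
    [C = A :&: C + B :&: C] lies in the span of meets of [A], [B] and [C]; the
    members added after these three contribute at most [t], since they meet [C]
    in codimension [t], so [D <= 2 k + (n - 1) t]. Distinct members force [t > 0],
    and then both estimates are within the claimed one.

    All this takes place in the span of finitely many finite-dimensional
    subspaces, which is identified with a space of row vectors. *)

Set Implicit Arguments.
Unset Strict Implicit.
Unset Printing Implicit Defensive.

Section MeetDimension.
Variables (F : fieldType) (vT : vectType F).
Implicit Types U V W : {vspace vT}.

Lemma ltn_dim_capv U V : U != V -> \dim U = \dim V -> (\dim (U :&: V) < \dim U)%N.
Proof.
move=> UV dimUV; rewrite (ltn_leqif (dimv_leqif_eq (capvSl U V))).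
apply: contraNneq UV => UV_U.
have U_sub_V : (U <= V)%VS by rewrite -UV_U capvSr.
by rewrite eqEdim U_sub_V dimUV /=.
Qed.

Lemma dim_cap3_leqif U V W :
  (\dim (U :&: W) + \dim (V :&: W) <= \dim (U :&: V :&: W) + \dim W
     ?= iff (W <= U :&: W + V :&: W)%VS)%N.
Proof.
rewrite -dimv_sum_cap addnC.
have -> : (U :&: W :&: (V :&: W) = U :&: V :&: W)%VS.
  by rewrite capvA -(capvA U) (capvC W) capvA -capvA capvv.
rewrite -[(W <= _)%VS]andTb; apply: leqif_add; first exact/leqif_refl.
by apply: dimv_leqif_sup; rewrite subv_add !capvSr.
Qed.

End MeetDimension.

Section SubspaceFamilies.
(* [Defs] re-exports [classical_sets], which shadows many lemma names of [finset]. *)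
Import fintype boot.finset.
Variables (F : fieldType) (vT : vectType F) (T : finType) (p : T -> {vspace vT}).
Implicit Types (A B : {set T}) (a b c x : T).

Definition family_join A : {vspace vT} := (\sum_(i in A) p i)%VS.

Definition family_meets A : {vspace vT} :=
  (\sum_(ij | [&& ij.1 \in A, ij.2 \in A & ij.1 != ij.2]) (p ij.1 :&: p ij.2))%VS.

Definition dim_join_meets A : nat :=
  (\dim (family_join A) + \dim (family_meets A))%N.

Lemma family_join_sup A x : x \in A -> (p x <= family_join A)%VS.
Proof. by move=> Ax; apply: (sumv_sup x). Qed.

Lemma family_meets_sup A a b :
  a \in A -> b \in A -> a != b -> (p a :&: p b <= family_meets A)%VS.
Proof. by move=> Aa Ab ab; apply: (sumv_sup (a, b)); rewrite //= Aa Ab. Qed.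

Lemma family_meets_subP A U :
  reflect (forall a b, a \in A -> b \in A -> a != b -> (p a :&: p b <= U)%VS)
          (family_meets A <= U)%VS.
Proof.
apply: (iffP subv_sumP) => [AU a b Aa Ab ab | AU [a b] /and3P[]]; last exact: AU.
by apply: (AU (a, b)); rewrite /= Aa Ab.
Qed.

Lemma family_meetsS A B : A \subset B -> (family_meets A <= family_meets B)%VS.
Proof.
move=> /subsetP AB; apply/family_meets_subP => a b /AB Ba /AB.
exact: family_meets_sup.
Qed.

Lemma family_meets_sub_join A : (family_meets A <= family_join A)%VS.
Proof.
apply/family_meets_subP => a b Aa _ _.
exact: subv_trans (capvSl _ _) (family_join_sup Aa).
Qed.

Lemma family_joinU1 x A :
  x \notin A -> family_join (x |: A) = (family_join A + p x)%VS.
Proof. by move=> xA; rewrite /family_join big_setU1 //= addvC. Qed.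

Lemma family_meetsU1_sub x A :
  (family_meets (x |: A) <= family_meets A + (p x :&: family_join A))%VS.
Proof.
have meet_x a : a \in A ->
    (p x :&: p a <= family_meets A + (p x :&: family_join A))%VS.
  by move=> Aa; rewrite (subv_trans _ (addvSr _ _)) // capvS // family_join_sup.
apply/family_meets_subP => a b /setU1P[-> | Aa] /setU1P[-> | Ab]; rewrite ?eqxx //.
- by move=> _; apply: meet_x.
- by move=> _; rewrite capvC; apply: meet_x.
- by move=> ab; rewrite (subv_trans _ (addvSl _ _)) // family_meets_sup.
Qed.

Lemma cap3_sub_meets2 a b c : a != b ->
  (p a :&: p b :&: p c <= p c :&: family_meets [set a; b])%VS.
Proof.
by move=> ab; rewrite [(p c :&: _)%VS]capvC capvS // family_meets_sup ?set21 ?set22.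
Qed.

Lemma dim_join_meetsU1 x A : x \notin A ->
  (dim_join_meets (x |: A) + \dim (p x :&: family_meets A)
   <= dim_join_meets A + \dim (p x))%N.
Proof.
move=> xA; rewrite /dim_join_meets family_joinU1 //.
have := dimvS (family_meetsU1_sub x A).
have /dimvS :
    (p x :&: family_meets A <= family_meets A :&: (p x :&: family_join A))%VS.
  by rewrite subv_cap capvSr capvS // family_meets_sub_join.
have := dimv_sum_cap (family_join A) (p x).
have := dimv_sum_cap (family_meets A) (p x :&: family_join A).
rewrite [(family_join A :&: p x)%VS]capvC; lia.
Qed.

Lemma dim_join_meets_extend A B w : A \subset B ->
  (forall x, x \in B :\: A -> \dim (p x) <= \dim (p x :&: family_meets A) + w)%N ->
  (dim_join_meets B <= dim_join_meets A + #|B :\: A| * w)%N.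
Proof.
have [n] := ubnP #|B :\: A|; elim: n => // n IHn in B *.
rewrite ltnS => leBn AB dim_new.
have [BA | [x BAx]] := set_0Vmem (B :\: A).
  suff -> : B = A by rewrite leq_addr.
  by apply/eqP; rewrite eqEsubset AB -setD_eq0 BA eqxx.
have [Bx xA] : x \in B /\ x \notin A by move: BAx; rewrite inE => /andP[].
have A_sub : A \subset B :\ x by rewrite subsetD1 AB.
have BxA : (B :\ x) :\: A = (B :\: A) :\ x by rewrite !setDDl setUC.
have cardBA : #|B :\: A| = #|(B :\: A) :\ x|.+1 by rewrite (cardsD1 x) BAx.
have ltBxA : (#|(B :\ x) :\: A| < n)%N by rewrite BxA -cardBA.
have dim_new_Bx y : y \in (B :\ x) :\: A ->
    (\dim (p y) <= \dim (p y :&: family_meets A) + w)%N.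
  by rewrite BxA inE => /andP[_]; apply: dim_new.
have := dim_join_meetsU1 (negbT (setD11 x B)); rewrite setD1K //.
have := IHn _ ltBxA A_sub dim_new_Bx; have := dim_new x BAx.
have := dimvS (capvS (subvv (p x)) (family_meetsS A_sub)).
rewrite BxA cardBA; nia.
Qed.

Lemma dim_join_meets2 a b : a != b ->
  (dim_join_meets [set a; b] <= \dim (p a) + \dim (p b))%N.
Proof.
move=> ab; rewrite -(dimv_sum_cap (p a)) leq_add //.
  by rewrite /family_join big_setU1 ?inE //= big_set1.
apply/dimvS/family_meets_subP => i j /set2P[] -> /set2P[] ->; rewrite ?eqxx //.
by rewrite capvC.
Qed.

End SubspaceFamilies.

Section EquidistantFamilies.
Import fintype boot.finset.
Variables (F : fieldType) (vT : vectType F) (T : finType) (p : T -> {vspace vT}).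
Variables k t : nat.
Hypothesis p_inj : injective p.
Hypothesis dim_p : forall a, \dim (p a) = k.
Hypothesis dim_pp : forall a b, a != b -> (\dim (p a :&: p b) + t = k)%N.
Implicit Types (A : {set T}) (a b c x : T).

Lemma equidistant_codim_gt0 a b : a != b -> (0 < t)%N.
Proof.
move=> ab; have := dim_pp ab.
have : (\dim (p a :&: p b) < k)%N.
  by rewrite -(dim_p a) ltn_dim_capv ?dim_p // (inj_eq p_inj).
lia.
Qed.

Lemma dim_cap3_ge a b c : c \notin [set a; b] ->
  (k <= \dim (p a :&: p b :&: p c) + 2 * t)%N.
Proof.
rewrite in_set2 negb_or ![c == _]eq_sym => /andP[/dim_pp dim_ac /dim_pp dim_bc].
have [+ _] := dim_cap3_leqif (p a) (p b) (p c); rewrite dim_p; lia.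
Qed.

Lemma cap3_min_sub_meets A a b c :
  a \in A -> b \in A -> c \in A -> c \notin [set a; b] ->
  (\dim (p a :&: p b :&: p c) + 2 * t)%N = k -> (p c <= family_meets p A)%VS.
Proof.
move=> Aa Ab Ac; rewrite in_set2 negb_or ![c == _]eq_sym => /andP[ac bc] dim_abc.
have [_ eq_dim] := dim_cap3_leqif (p a) (p b) (p c).
have : (p c <= p a :&: p c + p b :&: p c)%VS.
  rewrite -eq_dim dim_p; have := dim_pp ac; have := dim_pp bc; lia.
by move/subv_trans; apply; rewrite subv_add !family_meets_sup.
Qed.

Lemma dim_join_meets3 a b c : a != b -> c \notin [set a; b] ->
  (dim_join_meets p (c |: [set a; b]) <= 2 * k + 2 * t)%N.
Proof.
move=> ab c_new; have := dimvS (cap3_sub_meets2 p c ab).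
have := dim_join_meetsU1 p c_new; have := dim_join_meets2 p ab.
have := dim_cap3_ge c_new; rewrite !dim_p; lia.
Qed.

Lemma dim_join_meets_of_min_cap3 A a b c :
  a \in A -> b \in A -> c \in A -> a != b -> c \notin [set a; b] ->
  (\dim (p a :&: p b :&: p c) + 2 * t)%N = k ->
  (dim_join_meets p A <= 2 * k + (#|A| - 1) * t)%N.
Proof.
move=> Aa Ab Ac ab c_new dim_abc; set B := c |: [set a; b].
have [Ba Bb Bc] : [/\ a \in B, b \in B & c \in B] by rewrite !inE !eqxx !orbT.
have BA : B \subset A by rewrite !subUset !sub1set Aa Ab Ac.
have cardB : #|B| = 3 by rewrite cardsU1 c_new cards2 ab.
have dim_new x : x \in A :\: B ->
    (\dim (p x) <= \dim (p x :&: family_meets p B) + t)%N.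
  move=> /setDP[_ xB]; have xc : x != c by apply: contraNneq xB => ->.
  rewrite dim_p -(dim_pp xc) leq_add2r dimvS // capvS //.
  exact: cap3_min_sub_meets dim_abc.
have := dim_join_meets_extend BA dim_new.
have := dim_join_meets3 ab c_new; have := subset_leq_card BA.
rewrite cardsD (setIidPr BA) -/B cardB; nia.
Qed.

Lemma dim_join_meets_of_large_cap3 A a b : a \in A -> b \in A -> a != b ->
  (forall x, x \in A :\: [set a; b] -> k < \dim (p a :&: p b :&: p x) + 2 * t)%N ->
  (dim_join_meets p A <= 2 * k + (#|A| - 2) * (2 * t - 1))%N.
Proof.
move=> Aa Ab ab dim_abx.
have BA : [set a; b] \subset A by rewrite subUset !sub1set Aa.
have dim_new x : x \in A :\: [set a; b] ->
    (\dim (p x) <= \dim (p x :&: family_meets p [set a; b]) + (2 * t - 1))%N.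
  move=> /dim_abx; have := dimvS (cap3_sub_meets2 p x ab).
  rewrite dim_p; have := equidistant_codim_gt0 ab; lia.
have := dim_join_meets_extend BA dim_new; have := dim_join_meets2 p ab.
rewrite cardsD (setIidPr BA) cards2 ab !dim_p; lia.
Qed.

Lemma dim_join_meets_equidistant A : (2 < #|A|)%N ->
  (dim_join_meets p A + (#|A| - 3) <= 2 * k + 2 * (#|A| - 2) * t)%N.
Proof.
move=> A_gt2; have /card_gt1P[a [b [Aa Ab ab]]] := ltnW A_gt2.
have t_gt0 := equidistant_codim_gt0 ab.
have [/existsP[c /andP[/setDP[Ac c_new] /eqP dim_abc]] | no_min] :=
  boolP [exists c in A :\: [set a; b], \dim (p a :&: p b :&: p c) + 2 * t == k]%N.
- have := dim_join_meets_of_min_cap3 Aa Ab Ac ab c_new dim_abc; nia.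
- have large_cap3 x : x \in A :\: [set a; b] ->
      (k < \dim (p a :&: p b :&: p x) + 2 * t)%N.
    move=> Ax; have /setDP[_ /dim_cap3_ge] := Ax; rewrite ltn_neqAle => ->.
    rewrite andbT eq_sym; apply: contra no_min => min_x.
    by apply/existsP; exists x; rewrite Ax.
  have := dim_join_meets_of_large_cap3 Aa Ab ab large_cap3; nia.
Qed.

End EquidistantFamilies.

Import GRing.Theory.
Local Open Scope classical_set_scope.
Local Open Scope ring_scope.

Section SetSubspaces.
Variables (F : fieldType) (V : lmodType F).
Implicit Types A B U : set V.

Lemma is_subspaceP U :
  is_subspace U <-> U 0 /\ forall (a : F) u v, U u -> U v -> U (a *: u + v).
Proof.
split=> [[U0 Ulin] | [U0 Ulin]]; split; rewrite ?inE // in U0 *.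
  by move=> a u v Uu Uv; have := Ulin a u v; rewrite !inE; apply.
by move=> a u v; rewrite !inE; apply: Ulin.
Qed.

Lemma is_subspaceT : is_subspace [set: V].
Proof. exact/is_subspaceP. Qed.

Lemma subspace_sum U (I : Type) (r : seq I) (P : pred I) (u : I -> V) :
  is_subspace U -> (forall i, P i -> U (u i)) -> U (\sum_(i <- r | P i) u i).
Proof.
move=> /is_subspaceP[U0 Ulin] Uu; elim/big_rec: _ => // i v Pi Uv.
by rewrite -[u i]scale1r; apply: Ulin => //; apply: Uu.
Qed.

Lemma is_subspace_lspan A : is_subspace (lspan A).
Proof.
apply/is_subspaceP; split=> [U [/is_subspaceP[]] // | a u v Au Av U [Usub AU]].
have /is_subspaceP[_ Ulin] := Usub.
by apply: Ulin; [apply: Au | apply: Av].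
Qed.

Lemma sub_lspan A : A `<=` lspan A.
Proof. exact: sub_gen_smallest. Qed.

Lemma lspan_subset A B : A `<=` lspan B -> lspan A `<=` lspan B.
Proof. by move=> AB; apply: smallest_sub => //; apply: is_subspace_lspan. Qed.

Lemma lspan_eq A U : is_subspace U -> A `<=` U -> U `<=` lspan A -> lspan A = U.
Proof. by move=> Usub AU US; apply/seteqP; split=> //; apply: smallest_sub. Qed.

Lemma eq_lspan A B : A `<=` lspan B -> B `<=` lspan A -> lspan A = lspan B.
Proof. by move=> AB BA; apply/seteqP; split; apply: lspan_subset. Qed.

Lemma lspan_lincomb (I : finType) (b : I -> V) (c : I -> F) :
  lspan (range b) (\sum_i c i *: b i).
Proof.
have /is_subspaceP[lspan0 lspan_lin] := is_subspace_lspan (range b).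
apply: subspace_sum => [|i _]; first exact: is_subspace_lspan.
by rewrite -[_ *: _]addr0; apply: lspan_lin => //; apply: sub_lspan; exists i.
Qed.

End SetSubspaces.

Section LinearMaps.
Variables (F : fieldType) (V W : lmodType F) (f : {linear V -> W}).

Lemma is_subspace_image (U : set V) : is_subspace U -> is_subspace (f @` U).
Proof.
move=> /is_subspaceP[U0 Ulin]; apply/is_subspaceP; split.
  by exists 0; rewrite ?linear0.
move=> a _ _ [x Ux <-] [y Uy <-]; exists (a *: x + y); last by rewrite linearP.
exact: Ulin.
Qed.

Lemma is_subspace_preimage (U : set W) :
  is_subspace U -> is_subspace (f @^-1` U).
Proof.
move=> /is_subspaceP[U0 Ulin]; apply/is_subspaceP.
by split=> [|a x y Ux Uy] /=; rewrite ?linear0 ?linearP //; apply: Ulin.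
Qed.

Lemma lspan_image (A : set V) : lspan (f @` A) = f @` lspan A.
Proof.
apply: lspan_eq; first exact/is_subspace_image/is_subspace_lspan.
  by apply: image_subset; apply: sub_lspan.
rewrite image_sub; apply: smallest_sub.
  exact/is_subspace_preimage/is_subspace_lspan.
by rewrite -image_sub; apply: sub_lspan.
Qed.

End LinearMaps.

Section LinearCombinations.
Variables (F : fieldType) (V : lmodType F).
Implicit Type U : set V.

Definition lincomb (d : nat) (b : 'I_d -> V) (x : 'rV[F]_d) : V :=
  \sum_i x 0 i *: b i.

Fact lincomb_is_linear d (b : 'I_d -> V) : linear (lincomb b).
Proof.
move=> a x y; rewrite /lincomb scaler_sumr -big_split /=.
by apply: eq_bigr => i _; rewrite !mxE scalerDl scalerA.
Qed.

HB.instance Definition _ d (b : 'I_d -> V) :=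
  GRing.isLinear.Build F 'rV[F]_d V *:%R (lincomb b) (lincomb_is_linear b).

Lemma lspan_range d (b : 'I_d -> V) : lspan (range b) = range (lincomb b).
Proof.
apply: lspan_eq; first exact/is_subspace_image/is_subspaceT.
- move=> _ [i _ <-]; exists (delta_mx 0 i) => //.
  rewrite /lincomb (bigD1 i) //= big1 ?addr0 => [|j ji].
    by rewrite mxE !eqxx scale1r.
  by rewrite mxE (negbTE ji) andbF scale0r.
- by move=> _ [x _ <-]; apply: lspan_lincomb.
Qed.

Lemma lincomb_inj d (b : 'I_d -> V) : lin_indep b -> injective (lincomb b).
Proof.
move=> b_indep x y xy; apply/rowP => i; apply/eqP; rewrite -subr_eq0; apply/eqP.
have : lincomb b (x - y) = 0 by rewrite linearB /= xy subrr.
by move/(b_indep (fun i => (x - y) 0 i)) => /(_ i); rewrite !mxE.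
Qed.

Lemma has_dim_coordinates U d :
  has_dim U d -> exists2 f : {linear 'rV[F]_d -> V}, injective f & range f = U.
Proof.
move=> [b [b_indep <-]]; exists (lincomb b); first exact: lincomb_inj.
by rewrite -lspan_range.
Qed.

Lemma lspan_range_lift d (b : 'I_d.+1 -> V) (c : 'I_d.+1 -> F) i :
  \sum_j c j *: b j = 0 -> c i != 0 ->
  lspan (range (b \o lift i)) = lspan (range b).
Proof.
move=> cb0 ci; apply: eq_lspan => _ [j _ <-].
  by apply: sub_lspan; exists (lift i j).
case: (unliftP i j) => [l ->|->]; first by apply: sub_lspan; exists l.
have -> : b i = \sum_l (- (c (lift i l) / c i)) *: (b \o lift i) l.
  apply: (scalerI ci); apply/eqP.
  rewrite -subr_eq0 scaler_sumr -sumrN -[eqbRHS]cb0 [eqbRHS](bigD1_ord i) //=.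
  apply/eqP; congr (_ + _); apply: eq_bigr => l _.
  by rewrite scalerA mulrN mulrCA divff // mulr1 scaleNr opprK.
exact: lspan_lincomb.
Qed.

Lemma has_dim_lspan_range d (b : 'I_d -> V) : exists m, has_dim (lspan (range b)) m.
Proof.
elim: d b => [|d IHd] b; first by exists 0%N, b; split=> // c _ [].
have [b_indep | ] := pselect (lin_indep b); first by exists d.+1, b.
move=> /existsNP[c /not_implyP[cb0 /existsNP[i /eqP ci]]].
by rewrite -(lspan_range_lift cb0 ci); apply: IHd.
Qed.

Lemma has_dim_lspan_bigcup (I : finType) (U : I -> set V) (d : I -> nat) :
  (forall i, has_dim (U i) (d i)) -> exists m, has_dim (lspan (\bigcup_i U i)) m.
Proof.
move=> dimU; pose b i := sval (cid (dimU i)).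
have bU i : lspan (range (b i)) = U i by rewrite /b; case: cid => ? [].
pose e (l : 'I_#|{: {i & 'I_(d i)}}|) := b (tag (enum_val l)) (tagged (enum_val l)).
have e_b i j : range e (b i j).
  by exists (enum_rank (Tagged _ j)); rewrite // /e enum_rankK.
suff -> : lspan (\bigcup_i U i) = lspan (range e) by apply: has_dim_lspan_range.
apply: eq_lspan.
- move=> u [i _]; rewrite -bU; apply: lspan_subset => _ [j _ <-].
  exact: sub_lspan.
- move=> _ [l _ <-]; apply: sub_lspan; exists (tag (enum_val l)) => //.
  by rewrite -bU; apply: sub_lspan; exists (tagged (enum_val l)).
Qed.

End LinearCombinations.

Section InjectiveImages.
Variables (F : fieldType) (V W : lmodType F) (f : {linear W -> V}).
Hypothesis f_inj : injective f.
Implicit Type U : set W.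

Lemma lin_indep_comp d (b : 'I_d -> W) : lin_indep (f \o b) <-> lin_indep b.
Proof.
have sum_fb c : \sum_i c i *: (f \o b) i = f (\sum_i c i *: b i).
  by rewrite linear_sum; apply: eq_bigr => i _; rewrite linearZ.
split=> b_indep c; first by move=> cb0; apply: b_indep; rewrite sum_fb cb0 linear0.
by rewrite sum_fb -(linear0 f) => /f_inj; apply: b_indep.
Qed.

Lemma image_set_inj : injective (image^~ f : set W -> set V).
Proof.
move=> A B AB; apply/funext => x.
by rewrite -(image_inj f_inj) AB (image_inj f_inj).
Qed.

Lemma has_dim_image U d : has_dim (f @` U) d <-> has_dim U d.
Proof.
split=> [] [b [b_indep bU]]; last first.
  by exists (f \o b); rewrite lin_indep_comp -bU -lspan_image image_comp.
have b_im i : exists x, f x = b i.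
  have [x _ <-] : (f @` U) (b i) by rewrite -bU; apply: sub_lspan; exists i.
  by exists x.
have [a fa] := choice b_im.
have bE : b = f \o a by apply/funext => i; rewrite /= fa.
rewrite bE in b_indep bU; exists a; split; first exact/lin_indep_comp.
by apply: image_set_inj; rewrite -bU -lspan_image image_comp.
Qed.

End InjectiveImages.

Section VectorSpaceSets.
Variables (F : fieldType) (W : vectType F).
Implicit Types (A : {vspace W}) (U : set W).

Lemma is_subspace_vspace A : is_subspace [set` A].
Proof.
have [A0 Alin] := memv_submod_closed A.
by apply/is_subspaceP; split=> // a u v; apply: Alin.
Qed.

Lemma set_vspace_inj : injective (fun A => [set` A]).
Proof.
move=> A B /seteqP[AB BA]; apply/vspaceP => x.
by apply/idP/idP; [exact: AB | exact: BA].
Qed.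

Lemma lspan_nth d (X : d.-tuple W) :
  lspan (range (fun i : 'I_d => X`_i)) = [set` <<X>>%VS].
Proof.
apply: lspan_eq; first exact: is_subspace_vspace.
- by move=> _ [i _ <-]; rewrite /= memv_span // mem_nth // size_tuple.
- by move=> x /= /coord_span ->; apply: lspan_lincomb.
Qed.

Lemma has_dim_vspace A : has_dim [set` A] (\dim A).
Proof.
exists (fun i => (vbasis A)`_i); split; first exact/freeP/basis_free/vbasisP.
by rewrite lspan_nth (span_basis (vbasisP A)).
Qed.

Lemma exists_vspace_of_has_dim U d :
  has_dim U d -> exists2 A, \dim A = d & [set` A] = U.
Proof.
move=> [b [b_indep <-]]; pose X := [tuple b i | i < d].
have bE : b = fun i => X`_i by apply/funext => i; rewrite -tnth_nth tnth_mktuple.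
exists <<X>>%VS; last by rewrite bE lspan_nth.
have X_free : free X by apply/freeP; rewrite bE in b_indep.
by rewrite (eqnP X_free) size_tuple.
Qed.

Lemma lspan_bigcup_vspace (I : finType) (P : pred I) (A : I -> {vspace W}) :
  lspan (\bigcup_(i in [set i | P i]) [set` A i]) = [set` (\sum_(i | P i) A i)%VS].
Proof.
apply: lspan_eq; first exact: is_subspace_vspace.
- by move=> x [i /= Pi Ax]; apply: subvP Ax; apply: sumv_sup Pi _.
- move=> x /= /memv_sumP[y Ay ->].
  apply: subspace_sum => [|i Pi]; first exact: is_subspace_lspan.
  by apply: sub_lspan; exists i => //=; apply: Ay.
Qed.

End VectorSpaceSets.

Section VspaceImages.
Variables (F : fieldType) (V : lmodType F) (W : vectType F) (f : {linear W -> V}).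
Hypothesis f_inj : injective f.
Implicit Type A : {vspace W}.

Definition vspace_image A : set V := f @` [set` A].

Lemma vspace_image_cap A B :
  vspace_image (A :&: B) = vspace_image A `&` vspace_image B.
Proof.
apply/seteqP; split=> v.
- by move=> [x /= /memv_capP[Ax Bx] <-]; split; exists x.
- move=> [[x Ax <-] [y By /f_inj yx]].
  by exists x => //; apply/memv_capP; rewrite -{2}yx.
Qed.

Lemma lspan_bigcup_vspace_image (I : finType) (P : pred I) (A : I -> {vspace W}) :
  lspan (\bigcup_(i in [set i | P i]) vspace_image (A i))
  = vspace_image (\sum_(i | P i) A i).
Proof. by rewrite -image_bigcup lspan_image lspan_bigcup_vspace. Qed.

Lemma has_dim_vspace_image A : has_dim (vspace_image A) (\dim A).
Proof. exact/(has_dim_image f_inj)/has_dim_vspace. Qed.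

Lemma has_dim_vspace_image_eq A d : has_dim (vspace_image A) d -> \dim A = d.
Proof.
move=> /(has_dim_image f_inj)/exists_vspace_of_has_dim[B <-].
by move/set_vspace_inj->.
Qed.

Lemma exists_vspace_image (U : set V) d :
  has_dim U d -> U `<=` range f -> exists A, \dim A = d /\ vspace_image A = U.
Proof.
move=> dimU U_range; have preimU : f @` (f @^-1` U) = U.
  apply/seteqP; split=> [|u Uu]; first exact: image_preimage_subset.
  by have [x _ xu] := U_range u Uu; exists x; rewrite //= xu.
have /exists_vspace_of_has_dim[A dimA AU] : has_dim (f @^-1` U) d.
  by apply/(has_dim_image f_inj); rewrite preimU.
by exists A; rewrite // /vspace_image AU.
Qed.

Lemma lspan_family_join (T : finType) (p : T -> {vspace W}) :
  lspan (\bigcup_i vspace_image (p i)) = vspace_image (family_join p [set: T]).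
Proof.
rewrite -lspan_bigcup_vspace_image; congr lspan.
by apply: eq_bigcupl; split=> i //= _; rewrite finset.in_setT.
Qed.

Lemma lspan_family_meets n (p : 'I_n -> {vspace W}) :
  lspan [set v | exists i j : 'I_n,
    (i < j)%N /\ (vspace_image (p i) `&` vspace_image (p j)) v]
  = vspace_image (family_meets p [set: 'I_n]).
Proof.
rewrite -lspan_bigcup_vspace_image; congr lspan.
apply/seteqP; split=> v.
- move=> [i [j [ij vij]]]; exists (i, j); last by rewrite /= vspace_image_cap.
  by rewrite /= !finset.in_setT neq_ltn ij.
- move=> [[i j] /= /and3P[_ _]]; rewrite neq_ltn vspace_image_cap.
  by move=> /orP[ij | ji] [vi vj]; [exists i, j | exists j, i].
Qed.

End VspaceImages.

Lemma has_dim_family_coordinates (F : fieldType) (V : lmodType F) (I : finType)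
    (U : I -> set V) (d : I -> nat) :
  (forall i, has_dim (U i) (d i)) ->
  exists m (f : {linear 'rV[F]_m -> V}) (p : I -> {vspace 'rV[F]_m}),
    [/\ injective f, forall i, \dim (p i) = d i
      & forall i, vspace_image f (p i) = U i].
Proof.
move=> dimU; have [m dim_lspanU] := has_dim_lspan_bigcup dimU.
have [f f_inj f_range] := has_dim_coordinates dim_lspanU.
have U_sub i : U i `<=` range f.
  by rewrite f_range => v Uv; apply: sub_lspan; exists i.
have [p pP] := choice (fun i => exists_vspace_image f_inj (dimU i) (U_sub i)).
by exists m, f, p; split=> // i; case: (pP i).
Qed.

Theorem theorem4 (F : finFieldType) (V : lmodType F) (k t n : nat)
    (pi : 'I_n -> set V) :
  (0 <= t <= k)%N -> (2 * t <= k)%N -> (3 <= n)%N ->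
  injective pi ->
  is_SCID k (k - t)%N (range pi) ->
  exists dS dI : nat,
    [/\ has_dim (lspan (\bigcup_(i in setT) pi i)) dS,
        has_dim (lspan [set v | exists i j : 'I_n,
                                 (i < j)%N /\ (pi i `&` pi j) v]) dI
      & dS%:Z + dI%:Z
          <= 2 * k%:Z + 2 * (n%:Z - 2) * t%:Z - (n%:Z - 3)].
Proof.
move=> /andP[_ tk] _ n_gt2 pi_inj [_ dim_pi dim_piI].
have dim_pi_k i : has_dim (pi i) k by apply: dim_pi; exists i.
have [m [f [p [f_inj dim_p pE]]]] := has_dim_family_coordinates dim_pi_k.
have p_inj : injective p by move=> i j pij; apply: pi_inj; rewrite -!pE pij.
have dim_pp i j : i != j -> (\dim (p i :&: p j) + t = k)%N.
  move=> ij; rewrite -(subnK tk); congr (_ + t)%N.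
  apply: (has_dim_vspace_image_eq f_inj); rewrite vspace_image_cap // !pE.
  by apply: dim_piI; [exists i | exists j | move/pi_inj/eqP; apply/negP].
exists (\dim (family_join p [set: 'I_n])), (\dim (family_meets p [set: 'I_n])).
rewrite -(funext pE); split.
- by rewrite lspan_family_join; apply: has_dim_vspace_image.
- by rewrite lspan_family_meets //; apply: has_dim_vspace_image.
- have := dim_join_meets_equidistant p_inj dim_p dim_pp (A := [set: 'I_n]).
  by rewrite cardsT card_ord /dim_join_meets => /(_ n_gt2); nia.
Qed.
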